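(* Let $n\ge 1$. For every teleportation scheme for $n$ qubits with outcome probabilities $p_1,\dots,p_M$ and Bob's correction unitaries $V_1,\dots,V_M$, the set $\{p_k,V_k^\dagger\}_{k=1}^M$ is a quantum encryption set, i.e. $$\sum_{k=1}^M p_k V_k^\dagger\rho V_k=\frac{1}{2^n}I\quad\text{for every } 2^n\times 2^n\text{ density matrix }\rho .$$ Consequently every teleportation scheme for $n$ qubits requires at least $2n$ classical bits: $$H(p_1,\dots,p_M)=\sum_{k=1}^M p_k\log_2\frac1{p_k}\ \ge\ 2n .$$
   Context: A density matrix is a positive semidefinite matrix of trace $1$. A teleportation scheme for $n$ qubits consists of the following. Alice and Bob share a pure state $\rho_{AB}$ on $\mathbb{C}^{2^n}\otimes\mathbb{C}^{2^n}$ whose partial traces satisfy $\rho_A=\rho_B=\frac{1}{2^n}I$. Alice receives an unknown $n$-qubit state $\rho$ (a $2^n\times 2^n$ density matrix, on a system $S=\mathbb{C}^{2^n}$) and performs a joint measurement on $S\otimes A$, given by positive semidefinite operators $E_1,\dots,E_M$ on $S\otimes A$ with $\sum_k E_k=I$. Outcome $k$ occurs with probability $p_k$ (from a fixed list $p_1,\dots,p_M$, not depending on $\rho$) and is communicated classically to Bob using $H(p_1,\dots,p_M)$ bits; Bob then applies a $2^n\times 2^n$ unitary $V_k$ to his system and thereby retrieves $\rho$. That is, for every $\rho$ and every $k$, $$V_k\,\mathrm{Tr}_{SA}\big[(E_k\otimes I_B)(\rho\otimes\rho_{AB})\big]\,V_k^\dagger=p_k\,\rho .$$ The convention $0\log_2\frac10=0$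 is used. *)

(* Defs.v *)
From HB Require Import structures.
From mathcomp Require Import all_boot all_order all_algebra.
From mathcomp Require Import sesquilinear spectral.
From mathcomp Require Import all_classical all_reals all_analysis.
From mathcomp.real_closed Require Import complex mxtens.

Set Implicit Arguments.
Unset Strict Implicit.
Unset Printing Implicit Defensive.

Import Order.TTheory GRing.Theory Num.Theory.
Local Open Scope ring_scope.
Local Open Scope complex_scope.
Local Open Scope sesquilinear_scope.

(* The tensor factors of C^m (x) C^n are identified through mxtens: the basis
   vector e_i (x) e_j of C^m (x) C^n = C^(m * n) has index
   mxtens_index (i, j), and A *t B is the Kronecker product. *)

Section Matrices.
Variable R : realType.
Local Notation C := R[i].

Definition psdmx n (A : 'M[C]_n) : Prop :=
  A \is hermsymmx /\ forall x : 'cV[C]_n, 0 <= (x^t* *m A *m x) 0 0.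

Definition density_mx n (rho : 'M[C]_n) : Prop :=
  psdmx rho /\ \tr rho = 1.

Definition pure_state n (rho : 'M[C]_n) : Prop :=
  exists2 psi : 'cV[C]_n, psi^t* *m psi = 1%:M & rho = psi *m psi^t*.

(* Tr_1 : traces out the first factor of C^m (x) C^n. *)
Definition ptrace1 m n (A : 'M[C]_(m * n)) : 'M[C]_n :=
  \matrix_(i, j) \sum_(k < m) A (mxtens_index (k, i)) (mxtens_index (k, j)).

(* Tr_2 : traces out the second factor of C^m (x) C^n. *)
Definition ptrace2 m n (A : 'M[C]_(m * n)) : 'M[C]_m :=
  \matrix_(i, j) \sum_(k < n) A (mxtens_index (i, k)) (mxtens_index (j, k)).

(* S (x) (A (x) B) read as (S (x) A) (x) B.  This keeps every basis vector,
   since i * (n * p) + (j * p + k) = (i * n + j) * p + k. *)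
Definition assocmx m n p (A : 'M[C]_(m * (n * p))) : 'M[C]_(m * n * p) :=
  castmx (mulnA m n p, mulnA m n p) A.

(* (E (x) I_B) (rho (x) rhoAB), an operator on (S (x) A) (x) B. *)
Definition measured d (E : 'M[C]_(d * d)) (rho : 'M[C]_d)
    (rhoAB : 'M[C]_(d * d)) : 'M[C]_(d * d * d) :=
  (E *t (1%:M : 'M[C]_d)) *m assocmx (rho *t rhoAB).

End Matrices.

Record teleportation_scheme (R : realType) (n M : nat) := TeleportationScheme {
  ts_rhoAB : 'M[R[i]]_(2 ^ n * 2 ^ n);
  ts_E : 'I_M -> 'M[R[i]]_(2 ^ n * 2 ^ n);
  ts_p : 'I_M -> R;
  ts_V : 'I_M -> 'M[R[i]]_(2 ^ n);
  ts_pure : pure_state ts_rhoAB;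
  ts_rhoA : ptrace2 ts_rhoAB = ((2 ^ n)%:R^-1)%:M;
  ts_rhoB : ptrace1 ts_rhoAB = ((2 ^ n)%:R^-1)%:M;
  ts_E_psd : forall k, psdmx (ts_E k);
  ts_E_sum : \sum_k ts_E k = 1%:M;
  (* Born rule: outcome k has probability p_k whatever the input state is.
     As ts_E is a POVM, this forces p_k >= 0 and \sum_k p_k = 1. *)
  ts_prob : forall rho : 'M[R[i]]_(2 ^ n), density_mx rho ->
    forall k, \tr (measured (ts_E k) rho ts_rhoAB) = (ts_p k)%:C;
  ts_V_unitary : forall k, ts_V k \is unitarymx;
  ts_retrieve : forall rho : 'M[R[i]]_(2 ^ n), density_mx rho ->
    forall k, ts_V k *m ptrace1 (measured (ts_E k) rho ts_rhoAB)
                *m (ts_V k)^t* = (ts_p k)%:C *: rho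
}.

Definition quantum_encryption_set (R : realType) (n M : nat)
    (p : 'I_M -> R) (U : 'I_M -> 'M[R[i]]_(2 ^ n)) : Prop :=
  forall rho : 'M[R[i]]_(2 ^ n), density_mx rho ->
    \sum_k (p k)%:C *: (U k *m rho *m (U k)^t*) = ((2 ^ n)%:R^-1)%:M.

Definition log2 (R : realType) (x : R) : R := ln x / ln 2.

(* The convention 0 log2 (1/0) = 0 holds because the left factor is 0. *)
Definition shannon_entropy (R : realType) (M : nat) (p : 'I_M -> R) : R :=
  \sum_k p k * log2 (p k)^-1.

(* Main.v *)
(* Summing Bob's uncorrected states p_k V_k^* rho V_k over all outcomes removes
   the measurement, so the sum is Bob's marginal I / d with d = 2^n.  By
   linearity and polarization this holds for all matrices in place of rho.  The
   matrix units then show that the vectors sqrt(p_k) vec(U_k), U_k = V_k^*, form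
   a tight frame: sum_k p_k |tr (W^* U_k)|^2 = 1 for every unitary W.  The choice
   W = U_k gives p_k d^2 <= 1, so each log2 (1 / p_k) is at least 2n. *)
From HB Require Import structures.
Require Import Defs.
From mathcomp Require Import all_boot all_order all_algebra.
From mathcomp Require Import sesquilinear spectral.
From mathcomp Require Import all_classical all_reals all_analysis.
From mathcomp.real_closed Require Import complex mxtens.

Set Implicit Arguments.
Unset Strict Implicit.
Unset Printing Implicit Defensive.

Import Order.TTheory GRing.Theory Num.Theory.
Local Open Scope ring_scope.
Local Open Scope complex_scope.
Local Open Scope sesquilinear_scope.

(** * Product indices, adjoints and Kronecker products *)

Lemma sum_mxtens_index (V : nmodType) (m n : nat) (F : 'I_(m * n) -> V) :
  \sum_k F k = \sum_i \sum_j F (mxtens_index (i, j)).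
Proof.
rewrite pair_big (reindex (@mxtens_index m n)) /=; last first.
  by exists (@mxtens_unindex m n) => k _; rewrite ?mxtens_indexK ?mxtens_unindexK.
by apply: eq_bigr => -[].
Qed.

Lemma adjmxM (C : numClosedFieldType) (m n p : nat)
    (A : 'M[C]_(m, n)) (B : 'M[C]_(n, p)) : (A *m B)^t* = B^t* *m A^t*.
Proof. by rewrite trmx_mul map_mxM. Qed.

Lemma unitarymxPV (C : numClosedFieldType) (n : nat) (U : 'M[C]_n) :
  U \is unitarymx -> U^t* *m U = 1%:M.
Proof. by rewrite -trmxC_unitary => /unitarymxP; rewrite trmxCK. Qed.

Lemma tensmx_suml (K : pzRingType) (I : Type) (r : seq I) (P : pred I)
    (m n p q : nat) (A : I -> 'M[K]_(m, n)) (B : 'M[K]_(p, q)) :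
  (\sum_(i <- r | P i) A i) *t B = \sum_(i <- r | P i) A i *t B.
Proof.
apply/matrixP => i j; rewrite mxE !summxE mulr_suml.
by apply: eq_bigr => k _; rewrite mxE.
Qed.

(** * Entries and traces of the operators on S (x) A (x) B *)

Section Density.
Variable R : realType.
Local Notation C := R[i].

Lemma assocmx_tensE (m n p : nat) (A : 'M[C]_m) (B : 'M[C]_(n * p))
    (i i' : 'I_m) (j j' : 'I_n) (k k' : 'I_p) :
  assocmx (A *t B) (mxtens_index (mxtens_index (i, j), k))
                   (mxtens_index (mxtens_index (i', j'), k'))
  = A i i' * B (mxtens_index (j, k)) (mxtens_index (j', k')).
Proof.
have e (a : 'I_m) (b : 'I_n) (c : 'I_p) :
    cast_ord (esym (mulnA m n p)) (mxtens_index (mxtens_index (a, b), c))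
    = mxtens_index (a, mxtens_index (b, c)).
  by apply: val_inj; rewrite /= mulnDl mulnA addnA.
by rewrite /assocmx castmxE !e tensmxE.
Qed.

Lemma ptrace1_sum (m n M : nat) (A : 'I_M -> 'M[C]_(m * n)) :
  ptrace1 (\sum_k A k) = \sum_k ptrace1 (A k).
Proof.
apply/matrixP => i j; rewrite !(mxE, summxE).
under eq_bigr do rewrite summxE.
by rewrite exchange_big; apply: eq_bigr => k _; rewrite mxE.
Qed.

Lemma measured_sum (d M : nat) (E : 'I_M -> 'M[C]_(d * d)) (rho : 'M[C]_d)
    (s : 'M[C]_(d * d)) :
  \sum_k measured (E k) rho s = measured (\sum_k E k) rho s.
Proof.
by rewrite /measured tensmx_suml mulmx_suml.
Qed.

(** The identity on B kills every summand whose B-index differs from [k], so only the S and A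
    indices are summed. *)
Lemma measuredE (d : nat) (E : 'M[C]_(d * d)) (rho : 'M[C]_d)
    (s : 'M[C]_(d * d)) (i i' j j' k k' : 'I_d) :
  measured E rho s (mxtens_index (mxtens_index (i, j), k))
                   (mxtens_index (mxtens_index (i', j'), k'))
  = \sum_a \sum_b E (mxtens_index (i, j)) (mxtens_index (a, b)) *
      (rho a i' * s (mxtens_index (b, k)) (mxtens_index (j', k'))).
Proof.
rewrite mxE !sum_mxtens_index; apply: eq_bigr => a _; apply: eq_bigr => b _.
rewrite (bigD1 k) //= big1 => [|c neq_ck].
  by rewrite addr0 tensmxE assocmx_tensE !mxE eqxx mulr1.
by rewrite tensmxE !mxE eq_sym (negbTE neq_ck) mulr0 mul0r.
Qed.

(** Without a measurement S is uncorrelated with A and B, so tracing out S only contributes a scalar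
    and tracing out A leaves Bob's marginal. *)
Lemma ptrace1_measured1 (d : nat) (rho : 'M[C]_d) (s : 'M[C]_(d * d)) :
  ptrace1 (measured 1%:M rho s) = \tr rho *: ptrace1 s.
Proof.
apply/matrixP => k k'; rewrite !mxE sum_mxtens_index mulr_suml.
apply: eq_bigr => i _; rewrite mulr_sumr; apply: eq_bigr => j _.
rewrite measuredE (bigD1 i) //= (bigD1 j) //= !big1 ?addr0.
- by rewrite mxE eqxx mul1r.
- move=> a neq_ai; rewrite big1 // => b _.
  rewrite mxE (can_eq (@mxtens_indexK d d)) xpair_eqE.
  by rewrite eq_sym (negbTE neq_ai) mul0r.
- move=> b neq_bj.
  rewrite mxE (can_eq (@mxtens_indexK d d)) xpair_eqE andbC.
  by rewrite eq_sym (negbTE neq_bj) mul0r.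
Qed.

(** The operator acts trivially on B, so B can be traced out first; outcome probabilities thus see
    only Alice's marginal of [s]. *)
Lemma mxtrace_measured (d : nat) (E : 'M[C]_(d * d)) (rho : 'M[C]_d)
    (s : 'M[C]_(d * d)) :
  \tr (measured E rho s) = \tr (E *m (rho *t ptrace2 s)).
Proof.
rewrite /mxtrace !sum_mxtens_index; apply: eq_bigr => i _.
apply: eq_bigr => j _; under eq_bigr do rewrite measuredE.
rewrite mxE sum_mxtens_index exchange_big; apply: eq_bigr => a _.
rewrite exchange_big; apply: eq_bigr => b _.
by rewrite tensmxE mxE !mulr_sumr.
Qed.

(** * Positive semidefinite and density matrices *)

Lemma psdmx_trace_ge0 (n : nat) (A : 'M[C]_n) : psdmx A -> 0 <= \tr A.
Proof.
case=> _ A_ge0; apply: sumr_ge0 => i _.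
move: (A_ge0 (delta_mx i 0)).
by rewrite trmx_delta map_delta_mx -rowE -colE !mxE.
Qed.

Lemma psdmx_col_adj (n : nat) (x : 'cV[C]_n) : psdmx (x *m x^t*).
Proof.
split=> [|y].
  by apply/is_hermitianmxP; rewrite expr0 scale1r adjmxM trmxCK.
rewrite !mulmxA -mulmxA -[y^t* *m x]trmxCK adjmxM trmxCK.
by rewrite mxE big_ord1 !mxE mulrC mul_conjC_ge0.
Qed.

Lemma psdmxZ (n : nat) (c : C) (A : 'M[C]_n) :
  0 <= c -> psdmx A -> psdmx (c *: A).
Proof.
move=> c_ge0 [/is_hermitianmxP A_herm A_ge0]; split=> [|x].
  apply/is_hermitianmxP; rewrite linearZ /= map_mxZ /= (conj_Creal (ger0_real c_ge0)).
  by rewrite expr0 scale1r {1}A_herm expr0 scale1r.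
by rewrite -scalemxAr -scalemxAl mxE mulr_ge0.
Qed.

Lemma density_mx_maximally_mixed (d : nat) :
  (0 < d)%N -> density_mx ((d%:R^-1)%:M : 'M[C]_d).
Proof.
move=> d_gt0; split; last first.
  by rewrite mxtrace_scalar -[_ *+ _]mulr_natl mulfV // pnatr_eq0 -lt0n.
split=> [|x].
  apply/is_hermitianmxP; rewrite expr0 scale1r tr_scalar_mx map_scalar_mx /=.
  by rewrite conj_Creal // rpredV realn.
rewrite mul_mx_scalar -scalemxAl !mxE mulr_ge0 ?invr_ge0 ?ler0n //.
by apply: sumr_ge0 => i _; rewrite !mxE mulrC mul_conjC_ge0.
Qed.

(* Rank-one projectors are density matrices up to scaling, and polarization
   recovers every rank-one matrix [x *m y^t*] from them. *)
Lemma linear_density_eq0 (V : lmodType C) (d : nat)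
    (f : {linear 'M[C]_d -> V}) :
  (forall rho, density_mx rho -> f rho = 0) -> forall A, f A = 0.
Proof.
move=> f0 A.
have fxx (x : 'cV[C]_d) : f (x *m x^t*) = 0.
  have trE : \tr (x *m x^t*) = \sum_i x i 0 * (x i 0)^*.
    by apply: eq_bigr => i _; rewrite mxE big_ord1 !mxE.
  (* The trace is the squared norm of [x]: either [x] is zero or dividing by the trace gives a
     density matrix. *)
  have [tr0|tr_neq0] := eqVneq (\tr (x *m x^t*)) 0.
    suff -> : x = 0 by rewrite mul0mx linear0.
    apply/matrixP => i j; rewrite ord1 mxE; apply/eqP.
    rewrite -mul_conjC_eq0; apply/eqP; move: i {j} isT.
    by apply: psumr_eq0P => [i _|]; rewrite ?mul_conjC_ge0 -?trE.
  rewrite -[x *m _](scalerKV tr_neq0) linearZ /= f0 ?scaler0 //.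
  have psd_xx := psdmx_col_adj x.
  split; last by rewrite mxtraceZ mulVf.
  by apply: psdmxZ => //; rewrite invr_ge0 psdmx_trace_ge0.
have fsym (x y : 'cV[C]_d) : f (x *m y^t*) + f (y *m x^t*) = 0.
  have := fxx (x + y).
  by rewrite linearD /= map_mxD mulmxDl !mulmxDr !linearD /= !fxx add0r addr0.
have fxy (x y : 'cV[C]_d) : f (x *m y^t*) = 0.
  (* The conjugate-linear slot turns 'i into -'i, so this instance says that [f] agrees on the two
     mixed products; [fsym x y] says that their sum is 0. *)
  have := fsym x ('i *: y).
  rewrite linearZ /= map_mxZ -scalemxAr -scalemxAl !linearZ /= conjCi scaleNr.
  rewrite addrC -scalerBr => /eqP.
  rewrite scaler_eq0 (negbTE (neq0Ci _)) subr_eq0 /= => /eqP fyx.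
  have /eqP := fsym x y.
  rewrite fyx -mulr2n -scaler_nat scaler_eq0 pnatr_eq0 /=.
  by move/eqP.
rewrite (matrix_sum_delta A) !linear_sum big1 //= => i _.
rewrite linear_sum big1 //= => j _; rewrite linearZ /=.
suff -> : delta_mx i j = delta_mx i (0 : 'I_1) *m (delta_mx j (0 : 'I_1))^t* :> 'M[C]_d.
  by rewrite fxy scaler0.
by rewrite trmx_delta map_delta_mx mul_delta_mx.
Qed.

End Density.

(** * Encryption sets of unitaries *)

Section Encryption.
Variables (R : realType) (n M : nat) (p : 'I_M -> R).
Variable (U : 'I_M -> 'M[R[i]]_(2 ^ n)).
Local Notation C := R[i].
Local Notation d := (2 ^ n)%N.
Hypothesis U_unitary : forall k, U k \is unitarymx.
Hypothesis U_encrypts : quantum_encryption_set p U.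

(** The difference of the two sides is linear in [A] and vanishes on density matrices, whose trace
    is 1. *)
Lemma encryption_linear (A : 'M[C]_d) :
  \sum_k (p k)%:C *: (U k *m A *m (U k)^t*) = (\tr A * d%:R^-1)%:M.
Proof.
pose f (B : 'M[C]_d) :=
  \sum_k (p k)%:C *: (U k *m B *m (U k)^t*) - (\tr B * d%:R^-1)%:M.
have f_linear : linear f.
  move=> c B D; rewrite /f scalerBr scale_scalar_mx mulrA.
  rewrite mxtraceD mxtraceZ mulrDl raddfD opprD addrACA; congr (_ + _).
  rewrite scaler_sumr -big_split; apply: eq_bigr => k _ /=.
  by rewrite mulmxDr mulmxDl scalerDr -scalemxAr -scalemxAl !scalerA mulrC.
pose F : {linear 'M[C]_d -> 'M[C]_d} := HB.pack f (GRing.isLinear.Build _ _ _ _ f f_linear).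
apply/eqP; rewrite -subr_eq0; apply/eqP.
apply: (@linear_density_eq0 R _ _ F) => rho rho_density /=.
have [_ tr1] := rho_density.
by rewrite /f U_encrypts // tr1 mul1r subrr.
Qed.

(** Let B be the adjoint of [W] times [U k]. Then |tr B|^2 is the sum over i, j of B_ii times the
    conjugate of B_jj, which is the (i, j) entry of [delta_mx i j] conjugated by B. Averaging over
    [k] turns that entry into 1/d if i = j and 0 otherwise; the d diagonal terms add up to 1. *)
Lemma encryption_mxtrace_sqr (W : 'M[C]_d) : W \is unitarymx ->
  \sum_k (p k)%:C * `|\tr (W^t* *m U k)| ^+ 2 = 1.
Proof.
move=> W_unitary.
have trE k : `|\tr (W^t* *m U k)| ^+ 2
    = \sum_i \sum_j (W^t* *m (U k *m delta_mx i j *m (U k)^t*) *m W) i j.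
  rewrite normCK rmorph_sum mulr_suml; apply: eq_bigr => i _.
  rewrite mulr_sumr; apply: eq_bigr => j _.
  rewrite -(mul_delta_mx (0 : 'I_1)) !mulmxA -colE -!mulmxA.
  have -> : (U k)^t* *m W = (W^t* *m U k)^t* by rewrite adjmxM trmxCK.
  by rewrite -rowE; move: (W^t* *m U k) => B; rewrite [RHS]mxE big_ord1 !mxE.
have sumE i j :
    \sum_k (p k)%:C * (W^t* *m (U k *m delta_mx i j *m (U k)^t*) *m W) i j
    = (i == j)%:R * d%:R^-1.
  transitivity ((W^t* *m (\tr (delta_mx i j : 'M[C]_d) * d%:R^-1)%:M *m W) i j).
    rewrite -encryption_linear mulmx_sumr mulmx_suml summxE.
    by apply: eq_bigr => k _; rewrite -scalemxAr -scalemxAl [RHS]mxE.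
  rewrite mul_mx_scalar -scalemxAl unitarymxPV // !mxE.
  have [<-|neq_ij] := eqVneq i j; last by rewrite mulr0 mul0r.
  (* Cyclicity reduces the trace of the rank-one diagonal unit to that of a 1 x 1 matrix. *)
  by rewrite mulr1 -(mul_delta_mx (0 : 'I_1)) mxtrace_mulC mul_delta_mx trace_mx11 mxE.
under eq_bigr do rewrite trE mulr_sumr.
rewrite exchange_big /= (eq_bigr (fun=> d%:R^-1)) => [|i _].
  by rewrite sumr_const card_ord -[LHS]mulr_natl mulfV // pnatr_eq0 expn_eq0.
under eq_bigr do rewrite mulr_sumr.
rewrite exchange_big /= (bigD1 i) //= sumE eqxx mul1r big1 ?addr0 // => j neq_ji.
by rewrite sumE eq_sym (negbTE neq_ji) mul0r.
Qed.

Lemma encryption_prob_le (k : 'I_M) : (forall l, 0 <= p l) ->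
  p k <= (2 ^ (2 * n))%:R^-1.
Proof.
move=> p_ge0.
have := encryption_mxtrace_sqr (U_unitary k).
rewrite (bigD1 k) //= unitarymxPV // mxtrace1 normr_nat => sum1.
have : (p k)%:C * d%:R ^+ 2 <= 1.
  rewrite -[leRHS]sum1 lerDl sumr_ge0 // => l _.
  by rewrite mulr_ge0 ?exprn_ge0 // lecR.
rewrite -natrX -expnM mulnC => le1.
rewrite -[leRHS]mul1r ler_pdivlMr ?ltr0n ?expn_gt0 //.
by rewrite -lecR rmorphM rmorph_nat.
Qed.

(** Take traces in the encryption identity at the maximally mixed state: unitary conjugation
    preserves the trace. *)
Lemma encryption_prob_sum : \sum_k p k = 1.
Proof.
have d_gt0 : (0 < d)%N by rewrite expn_gt0.
have mixed := density_mx_maximally_mixed R d_gt0.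
have /(congr1 mxtrace) := U_encrypts mixed.
have [_ ->] := mixed; rewrite raddf_sum /= => sum1.
apply: (fmorph_inj (real_complex R)); rewrite rmorph_sum rmorph1 -[RHS]sum1.
apply: eq_bigr => k _; rewrite mxtraceZ mxtrace_mulC mulmxA unitarymxPV //.
by rewrite mul1mx mixed.2 mulr1.
Qed.

End Encryption.

(** * Entropy of a distribution with bounded probabilities *)

Lemma shannon_entropy_ge (R : realType) (M : nat) (p : 'I_M -> R) (c : R) :
  0 < c -> (forall k, 0 <= p k <= c^-1) -> \sum_k p k = 1 ->
  log2 c <= shannon_entropy p.
Proof.
move=> c_gt0 p_le p1.
(* Since the weights sum to 1, [log2 c] is spread over the outcomes and compared termwise. *)
rewrite -[leLHS]mul1r -p1 mulr_suml; apply: ler_sum => k _.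
have /andP[p_ge0 pc] := p_le k.
(* Outcomes of probability 0 are set aside because monotonicity of [ln] needs positive arguments. *)
have [->|p_neq0] := eqVneq (p k) 0; first by rewrite !mul0r.
have p_gt0 : 0 < p k by rewrite lt_def p_neq0.
apply: ler_wpM2l => //; rewrite /log2 ler_pM2r ?invr_gt0 ?ln_gt0 ?ltr1n //.
by rewrite ler_ln ?posrE ?invr_gt0 // -[c]invrK lef_pV2 // ?posrE ?invr_gt0.
Qed.

Lemma log2_expn (R : realType) (n : nat) : log2 (2 ^ n)%:R = n%:R :> R.
Proof.
rewrite /log2 natrX lnXn // -[X in X / _]mulr_natl mulfK //.
by rewrite gt_eqF // ln_gt0 // ltr1n.
Qed.

(** * From teleportation to encryption *)

Section Teleportation.
Variables (R : realType) (n M : nat) (T : teleportation_scheme R n M).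

(** The Born rule at the maximally mixed input, with Alice's marginal I/d, makes p_k equal to
    tr(E_k) / d^2. *)
Lemma teleportation_prob_ge0 (k : 'I_M) : 0 <= ts_p T k.
Proof.
have d_gt0 : (0 < 2 ^ n)%N by rewrite expn_gt0.
have d_ge0 : 0 <= (2 ^ n)%:R^-1 :> R[i] by rewrite invr_ge0 ler0n.
rewrite -lecR -(ts_prob T (density_mx_maximally_mixed R d_gt0)).
rewrite mxtrace_measured ts_rhoA.
suff -> : (2 ^ n)%:R^-1%:M *t (2 ^ n)%:R^-1%:M
    = ((2 ^ n)%:R^-1 ^+ 2)%:M :> 'M[R[i]]_(2 ^ n * 2 ^ n).
  rewrite mul_mx_scalar mxtraceZ mulr_ge0 ?exprn_ge0 //.
  exact: psdmx_trace_ge0 (ts_E_psd T k).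
apply/matrixP => i j.
rewrite -(mxtens_unindexK i) -(mxtens_unindexK j).
case: (mxtens_unindex i) (mxtens_unindex j) => [a b] [a' b'].
rewrite tensmxE !mxE (can_eq (@mxtens_indexK _ _)) xpair_eqE.
by case: (a == a'); case: (b == b'); rewrite ?mulr0 ?mul0r.
Qed.

Lemma teleportation_encrypts :
  quantum_encryption_set (ts_p T) (fun k => (ts_V T k)^t*).
Proof.
move=> rho rho_density; have [_ tr1] := rho_density.
rewrite (eq_bigr (fun k => ptrace1 (measured (ts_E T k) rho (ts_rhoAB T)))).
  by rewrite -ptrace1_sum measured_sum ts_E_sum ptrace1_measured1 tr1 scale1r ts_rhoB.
(* Conjugating the retrieval equation by the adjoint of V_k undoes Bob's correction. *)
move=> k _; rewrite trmxCK scalemxAl scalemxAr -(ts_retrieve T rho_density).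
have VV := unitarymxPV (ts_V_unitary T k).
by rewrite !mulmxA VV mul1mx -mulmxA VV mulmx1.
Qed.

End Teleportation.

Theorem mainTheorem3 (R : realType) (n M : nat) (hn : (1 <= n)%N)
    (T : teleportation_scheme R n M) :
  quantum_encryption_set (ts_p T) (fun k => (ts_V T k)^t*)
  /\ (2 * n)%:R <= shannon_entropy (ts_p T).
Proof.
have encrypts := teleportation_encrypts T.
have V_unitary k : (ts_V T k)^t* \is unitarymx.
  by rewrite trmxC_unitary ts_V_unitary.
(* Writing 2n as [log2] of 2^(2n) = d^2 makes the bound p_k <= 1/d^2 the one required. *)
split=> //; rewrite -log2_expn; apply: shannon_entropy_ge.
- by rewrite ltr0n expn_gt0.
- move=> k; rewrite teleportation_prob_ge0 /=.
  exact: encryption_prob_le V_unitary encrypts _ (teleportation_prob_ge0 T).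
- exact: encryption_prob_sum V_unitary encrypts.
Qed.
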